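(* Let $T>0$, $H\in(0,1)$, $H\neq 1/2$, $x_0\in\mathbb{R}$, $b\in C^1_b$, $\sigma\in C^2_b$, and assume that the equation $dX_t=b(X_t)\,dt+\sigma(X_t)\,dB^H_t$, $t\in(0,T]$, $X_0=x_0$, has a unique solution $X$, given by the Doss-Sussmann representation $X_t=h(Y_t,B^H_t)$. Assume moreover that $\sigma$ is bounded away from $0$. Let $|H-1/2|<\beta<1/2$, let $B^n$ be the transport-process approximation of $B^H$ (with parameter $\beta$), and let $X^n$ be the solution of $dX^n_t=b(X^n_t)\,dt+\sigma(X^n_t)\,dB^n_t$, $X^n_0=x_0$, where the integral is defined pathwise. Then for each $\delta>0$ such that $\beta+\delta<1/2$ there exist $q>0$ and a positive constant $C$ such that $$P\left(\sup_{0\le t\le T}|X_t-X^n_t|>C\,n^{-1/2+\beta+\delta}(\log n)^{5/2}\right)=o(n^{-q})\quad\text{as } n\to\infty.$$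
   Context: $C^i_b$ is the space of bounded functions $\mathbb{R}\to\mathbb{R}$ with continuous bounded derivatives of order $\le i$. Doss-Sussmann representation: $h:\mathbb{R}^2\to\mathbb{R}$ is the solution of $\frac{\partial h}{\partial x_2}(x_1,x_2)=\sigma(h(x_1,x_2))$, $h(x_1,0)=x_1$; one has $\frac{\partial h}{\partial x_1}(x_1,x_2)=\exp\left(\int_0^{x_2}\sigma'(h(x_1,s))ds\right)$. The process $Y$ is the pathwise solution of $Y'_t=\exp\left(-\int_0^{B^H_t}\sigma'(h(Y_t,s))ds\right)b(h(Y_t,B^H_t))$, $Y_0=x_0$. The solution of the stochastic differential equation is $X_t=h(Y_t,B^H_t)$. Fractional Brownian motion: $B^H$ is the centered Gaussian process with covariance $\frac12(s^{2H}+t^{2H}-|s-t|^{2H})$, realized as $B^H_t=C_H\left(\int_{-\infty}^0 f_t(s)dB(s)+\int_0^t g_t(s)dB(s)\right)$, $0\le t\le T$, where $B$ is a two-sided Brownian motion on $\mathbb{R}$, $C_H>0$ is the normalizing constant, $f_t(s)=(t-s)^{H-1/2}-(-s)^{H-1/2}$ for $s<0\le t$ and $g_t(s)=(t-s)^{H-1/2}$ for $s<t$. Fix $a<0$. Let $B_1$ be the restriction of $B$ to $[0,T]$, $B_2$ the restriction of $B$ to $[a,0]$, and $B_3(s)=sB(1/s)$ for $s\in[1/a,0)$, $B_3(0)=0$. Transport processes: a (uniform) transport process $Z^n$ is the position on the real line of a particle which starts from $0$ with velocity $+n$ or $-n$ (probability $1/2$ each) and switches the sign of its velocity at the ends of consecutive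 independent exponential holding times with parameter $n^2$; so its paths are continuous and piecewise linear with slopes $\pm n$. $Z^n_1,Z^n_2,Z^n_3$ are transport processes constructed from $B_1,B_2,B_3$ on the same probability space (via Skorohod embedding) so as to approximate them strongly; $Z^n_2$ and $Z^n_3$ are run backward in time from time $0$ along the negative half-line. Approximation $B^n$: let $\varepsilon_n=-n^{-\beta/|H-1/2|}$. Integrals with respect to $Z^n_i$ are pathwise, and $\partial_sf_t(1/v)$ is the derivative of $s\mapsto f_t(s)$ evaluated at $s=1/v$. For $H>1/2$, $$B^n_t=C_H\Big(\int_0^t g_t(s)dZ^n_1(s)+\int_a^0 f_t(s)dZ^n_2(s)+f_t(a)Z^n_2(a)+\int_{1/a}^0\Big(-\int_{1/a}^{s\wedge\varepsilon_n}\partial_sf_t\big(\tfrac1v\big)\tfrac{1}{v^3}dv\Big)dZ^n_3(s)\Big),$$ and for $H<1/2$, $$B^n_t=C_H\Big(\int_0^{(t+\varepsilon_n)\vee0}g_t(s)dZ^n_1(s)+\int_{(t+\varepsilon_n)\vee0}^t g_t(\varepsilon_n+s)dZ^n_1(s)+\int_a^{\varepsilon_n}f_t(s)dZ^n_2(s)+f_t(a)Z^n_2(a)+\int_{1/a}^0\Big(-\int_{1/a}^{s}\partial_sf_t\big(\tfrac1v\big)\tfrac{1}{v^3}dv\Big)dZ^n_3(s)\Big).$$ Known fact (earlier work, taken as given): with this construction, if $|H-1/2|<\beta<1/2$, then for each $q>0$ there is $C>0$ with $P\left(\sup_{0\le t\le T}|B^H_t-B^n_t|>Cn^{-1/2+\beta}(\log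 n)^{5/2}\right)=o(n^{-q})$ as $n\to\infty$. *)

(* Defs.v *)
From HB Require Import structures.
From mathcomp Require Import all_boot all_order all_algebra.
From mathcomp Require Import all_classical all_reals all_analysis.

Set Implicit Arguments.
Unset Strict Implicit.
Unset Printing Implicit Defensive.

Import Order.TTheory GRing.Theory Num.Theory.
Import numFieldNormedType.Exports.

Local Open Scope classical_set_scope.
Local Open Scope ring_scope.

Definition Cb (R : realType) (i : nat) (f : R -> R) : Prop :=
  (forall k : nat, (k < i)%N -> forall x : R, derivable (derive1n k f) x 1) /\
  (forall k : nat, (k <= i)%N ->
     continuous (derive1n k f : R -> R) /\ bounded_fun (derive1n k f : R -> R)).

(** Oriented Lebesgue integral: equals minus the integral over [b, a] when
    b < a, as needed for integrals up to B^H_t, which may be negative. *)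
Definition oint (R : realType) (a b : R) (f : R -> R) : R :=
  if a <= b then \int[lebesgue_measure]_(s in `[a, b]) f s
  else - \int[lebesgue_measure]_(s in `[b, a]) f s.

(** [RS_integral f g a b I]: the Riemann-Stieltjes sums of [f] against [g]
    over tagged partitions of [a, b], with arbitrary tags, tend to [I] as the
    mesh tends to 0 (for a <= b). *)
Definition RS_integral (R : realType) (f g : R -> R) (a b I : R) : Prop :=
  forall e : R, 0 < e -> exists2 r : R, 0 < r &
  forall (k : nat) (t c : nat -> R),
    t 0%N = a -> t k = b ->
    (forall i : nat, (i < k)%N ->
       [/\ t i <= c i, c i <= t i.+1 & t i.+1 - t i < r]) ->
    `|\sum_(i < k) f (c i) * (g (t i.+1) - g (t i)) - I| < e.

Definition RSint (R : realType) (a b : R) (f g : R -> R) : R :=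
  if a <= b then get (RS_integral f g a b) else - get (RS_integral f g b a).

(** [P A = o(n^-q)] for the events [A n].  Deviation events are suprema over
    uncountably many times, so probabilities are taken with the outer measure
    [P^*], which coincides with [P] on measurable sets. *)
Definition prob_littleo (R : realType) (d : measure_display)
    (Omega : measurableType d) (P : probability Omega R)
    (A : nat -> set Omega) (q : R) : Prop :=
  ((fun n : nat => fine ((P^*)%mu (A n))) : nat -> R) =o_\oo
  ((fun n : nat => n%:R `^ (- q)) : nat -> R).

Definition sup_dist (R : realType) (Omega : Type) (D : set R)
    (U V : R -> Omega -> R) (w : Omega) : \bar R :=
  ereal_sup [set (`|U t w - V t w|)%:E | t in D].

(** {sup_{0 <= t <= T} |U_t - V^n_t| > C n^p (log n)^(5/2)} *)
Definition deviation_event (R : realType) (Omega : Type) (T C p : R)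
    (U : R -> Omega -> R) (V : nat -> R -> Omega -> R) (n : nat) : set Omega :=
  [set w | ((C * n%:R `^ p * ln n%:R `^ (5 / 2))%:E
            < sup_dist `[0%R, T] U (V n) w)%E].

Definition mutually_independent (R : realType) (d : measure_display)
    (Omega : measurableType d) (P : probability Omega R) (I : eqType)
    (X : I -> Omega -> R) : Prop :=
  forall (s : seq I) (A : I -> set R), uniq s ->
    (forall i, measurable (A i)) ->
    fine (P (\bigcap_(i in [set` s]) (X i @^-1` A i))) =
    \prod_(i <- s) fine (P (X i @^-1` A i)).

(** The law N(m, s^2), including the degenerate case s = 0, for which
    [normal_prob] is not the Dirac mass. *)
Definition gaussian_law (R : realType) (m s : R) (A : set R) : \bar R :=
  if s == 0 then \d_m A else normal_prob m s A.

Definition has_law (R : realType) (d : measure_display)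
    (Omega : measurableType d) (P : probability Omega R)
    (X : Omega -> R) (mu : set R -> \bar R) : Prop :=
  forall A : set R, measurable A -> P (X @^-1` A) = mu A.

Definition gaussian_process (R : realType) (d : measure_display)
    (Omega : measurableType d) (P : probability Omega R) (D : set R)
    (X : R -> {RV P >-> R}) : Prop :=
  forall (k : nat) (t c : 'I_k -> R), (forall i, D (t i)) ->
    exists m s : R, 0 <= s /\
      has_law P (fun w => \sum_(i < k) c i * X (t i) w) (gaussian_law m s).

Definition brownian_two_sided (R : realType) (d : measure_display)
    (Omega : measurableType d) (P : probability Omega R)
    (B : R -> {RV P >-> R}) : Prop :=
  [/\ {ae P, forall w, B 0 w = 0},
      {ae P, forall w, continuous ((fun t => B t w) : R -> R)},
      (forall s t : R, s < t ->
         has_law P (fun w => B t w - B s w) (normal_prob 0 (Num.sqrt (t - s))))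
    & (forall (k : nat) (t : nat -> R), (forall i, t i <= t i.+1) ->
         mutually_independent P
           (fun (i : 'I_k) w => B (t i.+1) w - B (t i) w))].

Definition fractional_brownian (R : realType) (d : measure_display)
    (Omega : measurableType d) (P : probability Omega R) (H T : R)
    (X : R -> {RV P >-> R}) : Prop :=
  [/\ gaussian_process `[0, T] X,
      (forall t, 0 <= t <= T -> ('E_P[X t])%E = 0%E),
      (forall s t, 0 <= s <= T -> 0 <= t <= T ->
         covariance P (X s) (X t) =
         (2^-1 * (s `^ (2 * H) + t `^ (2 * H) - `|s - t| `^ (2 * H)))%:E)
    & {ae P, forall w, {within `[0, T], continuous ((fun t => X t w) : R -> R)}}].

(** A step function is a list of triples ((c, u), v) standing for the sum of
    the functions c 1_{]u, v]}. *)
Definition step_fun (R : realType) (phi : seq (R * R * R)) (s : R) : R :=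
  \sum_(p <- phi) p.1.1 * \1_`]p.1.2, p.2] s.

Definition step_int (R : realType) (Omega : Type) (B : R -> Omega -> R)
    (phi : seq (R * R * R)) (w : Omega) : R :=
  \sum_(p <- phi) p.1.1 * (B p.2 w - B p.1.2 w).

(** [I] is the integral over [D] of [f] with respect to [B]: the L^2(P)-limit
    of integrals of step functions converging to [f 1_D] in L^2(R). *)
Definition wiener_integral (R : realType) (d : measure_display)
    (Omega : measurableType d) (P : probability Omega R)
    (B : R -> {RV P >-> R}) (D : set R) (f : R -> R) (I : {RV P >-> R}) : Prop :=
  exists phi : nat -> seq (R * R * R),
  [/\ (forall k, all (fun p : R * R * R => p.1.2 <= p.2) (phi k)),
      (fun k => \int[lebesgue_measure]_(s in [set: R])
                  (((f s * \1_D s - step_fun (phi k) s) ^+ 2)%:E))%E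
        @ \oo --> (0 : \bar R)
    & (fun k => \int[P]_(w in [set: Omega])
                  (((I w - step_int B (phi k) w) ^+ 2)%:E))%E
        @ \oo --> (0 : \bar R)].

Definition f_ker (R : realType) (H t s : R) : R :=
  (t - s) `^ (H - 2^-1) - (- s) `^ (H - 2^-1).

Definition g_ker (R : realType) (H t s : R) : R := (t - s) `^ (H - 2^-1).

Definition moving_average (R : realType) (d : measure_display)
    (Omega : measurableType d) (P : probability Omega R) (H T CH : R)
    (B X : R -> {RV P >-> R}) : Prop :=
  forall t : R, 0 <= t <= T ->
  exists I J : {RV P >-> R},
    [/\ wiener_integral B `]-oo, 0[ (f_ker H t) I,
        wiener_integral B `[0, t] (g_ker H t) J
      & {ae P, forall w, X t w = CH * (I w + J w)}].

(** [Z] is, on [0, L], the transport process with velocities +n, -n and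
    exponential holding times of parameter n^2: [xi] is the initial sign,
    [tau k] the k-th holding time and [S k] the time of the k-th switch. *)
Definition transport_process (R : realType) (d : measure_display)
    (Omega : measurableType d) (P : probability Omega R) (n : nat) (L : R)
    (Z : R -> Omega -> R) : Prop :=
  exists (xi : {RV P >-> R}) (tau : nat -> {RV P >-> R}),
  let S := fun (k : nat) (w : Omega) => \sum_(i < k) tau i w in
  [/\ P (xi @^-1` [set 1]) = (2^-1)%:E /\ P (xi @^-1` [set -1]) = (2^-1)%:E,
      (forall k, has_law P (tau k) (exponential_prob (n%:R ^+ 2))),
      mutually_independent P
        (fun (k : nat) => if k is k'.+1 then (tau k' : Omega -> R) else xi)
    & {ae P, forall w, Z 0 w = 0 /\
         forall (k : nat) (t : R), S k w <= t <= S k.+1 w -> t <= L ->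
           Z t w = Z (S k w) w + n%:R * xi w * (-1) ^+ k * (t - S k w)}].

Definition B3 (R : realType) (Omega : Type) (B : R -> Omega -> R)
    (s : R) (w : Omega) : R :=
  if s == 0 then 0 else s * B s^-1 w.

Definition strong_approx (R : realType) (d : measure_display)
    (Omega : measurableType d) (P : probability Omega R) (D : set R)
    (Z : nat -> R -> Omega -> R) (B : R -> Omega -> R) : Prop :=
  {ae P, forall w, (fun n => sup_dist D (Z n) B w) @ \oo --> (0 : \bar R)}.

Definition eps (R : realType) (H beta : R) (n : nat) : R :=
  - (n%:R `^ (- (beta / `|H - 2^-1|))).

(** - int_{1/a}^u (d/ds f_t)(1/v) v^-3 dv *)
Definition inv_ker (R : realType) (H a t u : R) : R :=
  - oint a^-1 u (fun v => (derive1 (f_ker H t : R -> R)) v^-1 * (v ^+ 3)^-1).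

(** [z1], [z2], [z3] are the paths of the three transport processes. *)
Definition Bn_path_gt (R : realType) (H beta CH a : R) (n : nat)
    (z1 z2 z3 : R -> R) (t : R) : R :=
  CH * (RSint 0 t (g_ker H t) z1
        + RSint a 0 (f_ker H t) z2
        + f_ker H t a * z2 a
        + RSint a^-1 0
            (fun s => inv_ker H a t (Num.min s (eps H beta n))) z3).

Definition Bn_path_lt (R : realType) (H beta CH a : R) (n : nat)
    (z1 z2 z3 : R -> R) (t : R) : R :=
  let e := eps H beta n in
  let t' := Num.max (t + e) 0 in
  CH * (RSint 0 t' (g_ker H t) z1
        + RSint t' t (fun s => g_ker H t (e + s)) z1
        + RSint a e (f_ker H t) z2
        + f_ker H t a * z2 a
        + RSint a^-1 0 (fun s => inv_ker H a t s) z3).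

Definition Bn (R : realType) (Omega : Type) (H beta CH a : R)
    (Z1 Z2 Z3 : nat -> R -> Omega -> R) (n : nat) (t : R) (w : Omega) : R :=
  (if 2^-1 < H then Bn_path_gt else Bn_path_lt) R H beta CH a n
    (fun s => Z1 n s w) (fun s => Z2 n s w) (fun s => Z3 n s w) t.

(** dX = b(X) dt + sigma(X) dB^H, X_0 = x0 on [0, T].  The notion of stochastic
    integral against B^H is a parameter: [integral U V] says that [V] is the
    indefinite integral of [U]. *)
Definition solves_SDE (R : realType) (d : measure_display)
    (Omega : measurableType d) (P : probability Omega R) (T x0 : R)
    (b sigma : R -> R)
    (integral : (R -> Omega -> R) -> (R -> Omega -> R) -> Prop)
    (X : R -> {RV P >-> R}) : Prop :=
  exists V : R -> Omega -> R,
    integral (fun t w => sigma (X t w)) V /\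
    {ae P, forall w,
       [/\ {within `[0, T], continuous ((fun t => X t w) : R -> R)},
           X 0 w = x0
         & forall t, 0 <= t <= T ->
             X t w = x0 + (\int[lebesgue_measure]_(s in `[0, t]) b (X s w))
                     + V t w]}.

Definition unique_solution_SDE (R : realType) (d : measure_display)
    (Omega : measurableType d) (P : probability Omega R) (T x0 : R)
    (b sigma : R -> R)
    (integral : (R -> Omega -> R) -> (R -> Omega -> R) -> Prop)
    (X : R -> {RV P >-> R}) : Prop :=
  solves_SDE T x0 b sigma integral X /\
  forall X' : R -> {RV P >-> R}, solves_SDE T x0 b sigma integral X' ->
    {ae P, forall w, forall t, 0 <= t <= T -> X' t w = X t w}.

Definition solves_pathwise (R : realType) (T x0 : R) (b sigma g x : R -> R) :
    Prop :=
  [/\ {within `[0, T], continuous x}, x 0 = x0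
    & forall t, 0 <= t <= T ->
        exists2 I : R, RS_integral (fun s => sigma (x s)) g 0 t I &
          x t = x0 + (\int[lebesgue_measure]_(s in `[0, t]) b (x s)) + I].

Definition doss_flow (R : realType) (sigma : R -> R) (h : R -> R -> R) : Prop :=
  forall x1 : R, h x1 0 = x1 /\
    forall x2 : R, is_derive x2 (1 : R) (h x1 : R -> R) (sigma (h x1 x2)).

(** The random equation of Y along the path [g] of B^H; by continuity, the
    equation on ]0, T[ gives the one-sided derivatives at 0 and T. *)
Definition doss_path (R : realType) (T x0 : R) (b sigma : R -> R)
    (h : R -> R -> R) (g y : R -> R) : Prop :=
  [/\ {within `[0, T], continuous y}, y 0 = x0
    & forall t, 0 < t < T ->
        is_derive t (1 : R) y
          (expR (- oint 0 (g t) (fun s => (derive1 (sigma : R -> R)) (h (y t) s)))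
           * b (h (y t) (g t)))].

(* Main.v *)
(** Let F be a primitive of 1/sigma (Lamperti transform).  Both equations become
    additive in the noise: F(X) = V + B^H with V = F(Y), V' = (b/sigma)(X), and
    F(X^n) = W + B^n with W' = (b/sigma)(X^n).  For X this is the Doss-Sussmann
    representation, since F(h(y, r)) = F(y) + r.  For X^n, where B^n is only known
    to be an integrator for which the Riemann-Stieltjes integrals exist, it is a
    chain rule obtained from Henstock's lemma: on fine partitions the errors
    between the increments of the integral and sigma(X^n) times the increments of
    B^n are absolutely summable to something small, and dividing by sigma, which
    is bounded away from 0, preserves this.  As b/sigma is Lipschitz, Gronwall
    applied to V - W gives sup|X - X^n| <= C sup|B^H - B^n| pathwise with a
    deterministic C, so the deviation event for X lies in that for B^H. *)

Require Import Defs.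
From HB Require Import structures.
From mathcomp Require Import all_boot all_order all_algebra.
From mathcomp Require Import all_classical all_reals all_analysis.
From mathcomp Require Import ring lra.

Import Order.TTheory GRing.Theory Num.Theory.
Import numFieldNormedType.Exports.

Local Open Scope classical_set_scope.
Local Open Scope ring_scope.

Set Implicit Arguments.
Unset Strict Implicit.
Unset Printing Implicit Defensive.

(** * Riemann-Stieltjes sums *)

(** The partition is built one tagged cell at a time, so that sums are concatenated and refined by
    induction, without reindexing; [RS_sum_partition] returns to the indexed sums of
    [RS_integral]. *)
Inductive RS_sum {R : realType} (f g : R -> R) (r : R) : R -> R -> R -> Prop :=
| RS_sum_nil a : RS_sum f g r a a 0
| RS_sum_cons a c u b S : a <= c -> c <= u -> u - a < r ->
    RS_sum f g r u b S -> RS_sum f g r a b (f c * (g u - g a) + S).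

Lemma RS_sum_one {R : realType} (f g : R -> R) (r a c b : R) :
  a <= c -> c <= b -> b - a < r -> RS_sum f g r a b (f c * (g b - g a)).
Proof.
move=> ac cb br; rewrite -[X in RS_sum _ _ _ _ _ X]addr0.
by apply: RS_sum_cons => //; exact: RS_sum_nil.
Qed.

Lemma RS_sum_cat {R : realType} (f g : R -> R) (r a b c S1 S2 : R) :
  RS_sum f g r a b S1 -> RS_sum f g r b c S2 -> RS_sum f g r a c (S1 + S2).
Proof.
move=> h1 h2; elim: h1 h2 => [u|u v w z S uv vw wr _ IH] h2.
  by rewrite add0r.
by rewrite -addrA; apply: RS_sum_cons => //; exact: IH.
Qed.

Lemma RS_sum_big {R : realType} (f g : R -> R) (r : R) (u v : nat -> R) (k : nat) :
  (forall i, (i < k)%N -> RS_sum f g r (u i) (u i.+1) (v i)) ->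
  RS_sum f g r (u 0%N) (u k) (\sum_(i < k) v i).
Proof.
elim: k => [|k IH] H; first by rewrite big_ord0; exact: RS_sum_nil.
rewrite big_ord_recr/=; apply: RS_sum_cat (H k _) => //.
by apply: IH => i ik; apply: H; exact: ltnW.
Qed.

Lemma RS_sum_partition {R : realType} (f g : R -> R) (r a b S : R) :
  RS_sum f g r a b S -> exists (k : nat) (t c : nat -> R),
    [/\ t 0%N = a, t k = b,
     (forall i, (i < k)%N ->
        [/\ t i <= c i, c i <= t i.+1 & t i.+1 - t i < r])
    & S = \sum_(i < k) f (c i) * (g (t i.+1) - g (t i))].
Proof.
elim=> [u|u v w z S' uv vw wr _ [k [t [c [t0 tk H ->]]]]].
  by exists 0%N, (fun=> u), (fun=> u); split => //; rewrite big_ord0.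
exists k.+1, (fun i => if i is j.+1 then t j else u),
  (fun i => if i is j.+1 then c j else v); split => //.
  by move=> [_|i /H//]; rewrite t0.
by rewrite big_ord_recl/= t0.
Qed.

Lemma fine_partition {R : realType} (a b r : R) : a <= b -> 0 < r ->
  exists (k : nat) (u : nat -> R), [/\ u 0%N = a, u k = b &
    forall i, (i < k)%N -> u i <= u i.+1 /\ u i.+1 - u i < r].
Proof.
move=> ab r0; pose k := (Num.truncn ((b - a) / r)).+1.
have k0 : (0 : R) < k%:R by rewrite ltr0n.
have dk : (b - a) / k%:R < r.
  rewrite ltr_pdivrMr// mulrC -ltr_pdivrMr//.
  exact: truncnS_gt.
exists k, (fun i => a + i%:R * ((b - a) / k%:R)); split => [||i ik].
- by rewrite mul0r addr0.
- by rewrite mulrC divfK ?gt_eqF// addrC subrK.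
have -> : a + i.+1%:R * ((b - a) / k%:R) - (a + i%:R * ((b - a) / k%:R))
    = (b - a) / k%:R by rewrite -(@natr1 R i); ring.
split=> //; rewrite -(@natr1 R i) [(_ + 1) * _]mulrDl mul1r addrA lerDl.
by rewrite divr_ge0 ?subr_ge0// ltW.
Qed.

Lemma RS_sum_exists {R : realType} (f g : R -> R) (a b r : R) : a <= b -> 0 < r ->
  exists S, RS_sum f g r a b S.
Proof.
move=> ab r0; have [k [u [<- <- H]]] := fine_partition ab r0.
exists (\sum_(i < k) f (u i) * (g (u i.+1) - g (u i))).
apply: (@RS_sum_big _ _ _ _ _ (fun i => f (u i) * (g (u i.+1) - g (u i)))).
by move=> i /H[? ?]; exact: RS_sum_one.
Qed.

Lemma RS_integral_sum {R : realType} (f g : R -> R) (a b I e : R) :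
  RS_integral f g a b I -> 0 < e -> exists2 r : R, 0 < r &
    forall S, RS_sum f g r a b S -> `|S - I| < e.
Proof.
move=> /[apply] -[r r0 H]; exists r => // S /RS_sum_partition.
by move=> [k [t [c [t0 tk Ht ->]]]]; exact: H.
Qed.

Lemma RS_sum_le {R : realType} (f g : R -> R) (r r' a b S : R) : r <= r' ->
  RS_sum f g r a b S -> RS_sum f g r' a b S.
Proof.
move=> rr'; elim=> [u|u v w z S' uv vw wr _ IH]; first exact: RS_sum_nil.
by apply: RS_sum_cons => //; exact: lt_le_trans rr'.
Qed.

(** A fine sum over [a, c] near [J] can start with a fine sum over [a, b] near [I]; what remains is
    a sum over [b, c] near [J - I]. Integrability over [b, c] is not asserted: one such sum of mesh
    below [r] is all that the refinement in Henstock's lemma asks for. *)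
Lemma RS_sum_near_increment {R : realType} (f g : R -> R) (a b c I J r e : R) :
  a <= b -> b <= c ->
  RS_integral f g a b I -> RS_integral f g a c J -> 0 < r -> 0 < e ->
  exists2 S, RS_sum f g r b c S & `|S - (J - I)| <= e.
Proof.
move=> ab bc hI hJ r0 e0; have e20 : 0 < e / 2 by rewrite divr_gt0.
have [r1 r10 H1] := RS_integral_sum hI e20.
have [r2 r20 H2] := RS_integral_sum hJ e20.
pose m := Num.min r (Num.min r1 r2).
have m0 : 0 < m by rewrite !lt_min r0 r10.
have mr : m <= r by rewrite ge_min lexx.
have mr1 : m <= r1 by rewrite !ge_min lexx orbT.
have mr2 : m <= r2 by rewrite !ge_min lexx !orbT.
have [S0 hS0] := RS_sum_exists f g ab m0.
have [S hS] := RS_sum_exists f g bc m0.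
exists S; first exact: RS_sum_le hS.
have /ltW := H1 _ (RS_sum_le mr1 hS0).
have /ltW := H2 _ (RS_sum_le mr2 (RS_sum_cat hS0 hS)).
by rewrite !ler_norml => /andP[? ?] /andP[? ?]; apply/andP; split; lra.
Qed.

(* Henstock's lemma: intervals outside [Q] are refined until they contribute
   nothing, so the errors on the intervals in [Q] alone sum to something small;
   taking for [Q] the positive, then the negative errors bounds the sum of the
   absolute values. *)
Lemma RS_henstock {R : realType} (f g I : R -> R) (a s t T e : R) :
  (forall u, a <= u <= T -> RS_integral f g a u (I u)) ->
  a <= s -> t <= T -> s <= t -> 0 < e ->
  exists2 r : R, 0 < r & forall (k : nat) (u c : nat -> R),
    u 0%N = s -> u k = t ->
    (forall i, (i < k)%N -> [/\ u i <= c i, c i <= u i.+1 & u i.+1 - u i < r]) ->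
    \sum_(i < k) `|I (u i.+1) - I (u i) - f (c i) * (g (u i.+1) - g (u i))| <= e.
Proof.
move=> HI as_ tT st e0; have e80 : 0 < e / 8 by rewrite divr_gt0.
have aT : a <= t <= T by rewrite (le_trans as_ st).
have [r r0 Hr] := RS_integral_sum (HI t aT) e80.
exists r => // k u c u0 uk Hu.
have uge i : (i <= k)%N -> s <= u i.
  elim: i => [_|i IH ik]; first by rewrite u0.
  by have [h1 h2 _] := Hu i ik; apply: le_trans (IH (ltnW ik)) (le_trans h1 h2).
have ule i : (i <= k)%N -> u (k - i)%N <= t.
  elim: i => [_|i IH ik]; first by rewrite subn0 uk.
  have kk : (k - i.+1 < k)%N by rewrite ltn_subrL (leq_ltn_trans _ ik).
  have [h1 h2 _] := Hu _ kk; apply: le_trans (IH (ltnW ik)).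
  by rewrite subnSK in h2 => //; exact: le_trans h2.
have uIcc i : (i <= k)%N -> a <= u i <= T.
  move=> ik; rewrite (le_trans as_ (uge _ ik))/=.
  by have := ule (k - i)%N (leq_subr _ _); rewrite subKn// => /le_trans; exact.
have asT : a <= s <= T by rewrite as_ (le_trans st).
pose err i := I (u i.+1) - I (u i) - f (c i) * (g (u i.+1) - g (u i)).
have [r1 r10 Hr1] := RS_integral_sum (HI s asT) e80.
have m0 : 0 < Num.min r r1 by rewrite lt_min r0.
have [S0 hS0] := RS_sum_exists f g as_ m0.
have /ltW S0e : `|S0 - I s| < e / 8.
  by apply: Hr1; apply: RS_sum_le hS0; rewrite ge_min lexx orbT.
have {}hS0 : RS_sum f g r a s S0.
  by apply: RS_sum_le hS0; rewrite ge_min lexx.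
(* The integrals all start at [a], so [S0] completes the partition on [a, s]; intervals in [Q] keep
   their tags and the others are refined. The three errors e / 8 are those of [S0], of the whole sum
   up to [t], and of the refined intervals. *)
have sel (Q : nat -> bool) : `|\sum_(i < k | Q i) err i| <= 3 * (e / 8).
  (* At most [k] refined intervals, each with error at most [m], cost at most e / 8 together; the
     successor avoids a division by zero. *)
  pose m := e / 8 / k.+1%:R.
  have {}m0 : 0 < m by rewrite divr_gt0.
  have /choice[v Hv] i : exists v, (i < k)%N -> RS_sum f g r (u i) (u i.+1) v /\
      (if Q i then v = f (c i) * (g (u i.+1) - g (u i))
       else `|v - (I (u i.+1) - I (u i))| <= m).
    have [ik|] := ltnP i k; last by exists 0.
    have [h1 h2 h3] := Hu i ik.
    case: (Q i).
      exists (f (c i) * (g (u i.+1) - g (u i))) => _.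
      by split=> //; exact: RS_sum_one.
    have ui := uIcc i (ltnW ik); have ui1 := uIcc i.+1 ik.
    have [v hv vm] := RS_sum_near_increment (proj1 (andP ui)) (le_trans h1 h2)
      (HI _ ui) (HI _ ui1) r0 m0.
    by exists v.
  have hs : RS_sum f g r a t (S0 + \sum_(i < k) v i).
    apply: RS_sum_cat hS0 _; rewrite -u0 -uk.
    by apply: RS_sum_big => i /Hv[].
  have /ltW := Hr _ hs.
  have tel : I t - I s = \sum_(i < k) (I (u i.+1) - I (u i)).
    by rewrite -(big_mkord xpredT (fun i => I (u i.+1) - I (u i))) telescope_sumr// u0 uk.
  have -> : S0 + \sum_(i < k) v i - I t =
      (S0 - I s) + (\sum_(i < k | ~~ Q i) (v i - (I (u i.+1) - I (u i))) -
                    \sum_(i < k | Q i) err i).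
    rewrite [I t](_ : _ = I s + (I t - I s)); last by ring.
    rewrite tel opprD addrACA -sumrB (bigID (fun i : 'I_k => Q i))/= addrC.
    rewrite addrC; congr (_ + _); rewrite addrC; congr (_ + _).
    rewrite -sumrN; apply: eq_bigr => i Qi.
    by have [_] := Hv i (ltn_ord i); rewrite Qi /err => ->; ring.
  have : `|\sum_(i < k | ~~ Q i) (v i - (I (u i.+1) - I (u i)))| <= e / 8.
    apply: le_trans (ler_norm_sum _ _ _) _.
    apply: (@le_trans _ _ (\sum_(i < k) m)).
      rewrite big_mkcond/=; apply: ler_sum => i _; case: ifPn => [Qi|_]; last exact: ltW.
      by have [_] := Hv i (ltn_ord i); rewrite (negbTE Qi).
    rewrite sumr_const card_ord -[m *+ k]mulr_natl /m mulrCA ger_pMr ?divr_gt0//.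
    by rewrite ler_pdivrMr// mul1r ler_nat.
  move: S0e; rewrite !ler_norml => /andP[? ?] /andP[? ?] /andP[? ?].
  by apply/andP; split; lra.
(* Each sign contributes at most 3 (e / 8), and 6 (e / 8) <= e. *)
have := sel (fun i => ~~ (0 <= err i)); have := sel (fun i => 0 <= err i).
rewrite !ler_norml => /andP[_ pos] /andP[neg _].
rewrite (bigID (fun i : 'I_k => 0 <= err i))/=.
have -> : \sum_(i < k | 0 <= err i) `|err i| = \sum_(i < k | 0 <= err i) err i.
  by apply: eq_bigr => i ?; rewrite ger0_norm.
have -> : \sum_(i < k | ~~ (0 <= err i)) `|err i|
    = - \sum_(i < k | ~~ (0 <= err i)) err i.
  by rewrite -sumrN; apply: eq_bigr => i; rewrite -ltNge => ?; rewrite ltr0_norm.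
lra.
Qed.

(** * Lamperti transform and Doss-Sussmann flow *)

Lemma is_derive1_continuous {R : realType} (f : R -> R) (x df : R) :
  is_derive x (1 : R) f df -> {for x, continuous f}.
Proof.
move=> [fx _].
by apply: differentiable_continuous; apply/derivable1_diffP.
Qed.

(** The endpoints come in either order, because the lemma is also applied to successive values of a
    path, which need not increase. *)
Lemma mean_value {R : realType} (f df : R -> R) (a b : R) :
  (forall x, is_derive x (1 : R) f (df x)) ->
  exists2 c, Num.min a b <= c <= Num.max a b & f b - f a = df c * (b - a).
Proof.
move=> fd.
have fc A : {within A, continuous f}.
  by apply: continuous_subspaceT => x; exact: is_derive1_continuous (fd x).
case: (leP a b) => [ab|/ltW ab].
  by have [c + ->] := MVT_segment ab (fun x _ => fd x) (fc _); exists c.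
have [c cab e] := MVT_segment ab (fun x _ => fd x) (fc _); exists c => //.
by rewrite -[LHS]opprB e; ring.
Qed.

Lemma derive_lipschitz {R : realType} (f df : R -> R) (K : R) :
  (forall x, is_derive x (1 : R) f (df x)) -> (forall x, `|df x| <= K) ->
  forall x y, `|f x - f y| <= K * `|x - y|.
Proof.
move=> fd dfK x y; have [c _ ->] := mean_value y x fd.
by rewrite normrM ler_wpM2r.
Qed.

(** A change of sign would produce a zero by the intermediate value theorem, so the sign of [f 0] is
    the sign of [f] everywhere. *)
Lemma norm_bounded_below_sign {R : realType} (f : R -> R) (c : R) :
  continuous f -> 0 < c -> (forall x, c <= `|f x|) ->
  exists2 s : R, s * s = 1 & forall x, c <= s * f x.
Proof.
move=> fc c0 fge.
have fN0 x : f x != 0 by rewrite -normr_gt0 (lt_le_trans c0).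
exists (Num.sg (f 0)); first by rewrite -expr2 sqr_sg fN0.
move=> x; rewrite -(@ger0_norm _ (_ * f x)) ?normrM ?normr_sg ?fN0 ?mul1r//.
rewrite leNgt; apply/negP => fx.
have [y _ fy] : exists2 y, y \in `[Num.min 0 x, Num.max 0 x] & f y = 0.
  have f0N := fN0 0; have fxN := fN0 x.
  apply: IVT; first by rewrite ge_min !le_max lexx.
    exact: continuous_subspaceT.
  case: (ltgtP 0 (f 0)) f0N fx => // f0 _.
  - rewrite gtr0_sg// mul1r => fx; have := ltW f0; have := ltW fx.
    by case: (leP 0 x) => _ ? ?; rewrite ge_min le_max;
      apply/andP; split; apply/orP; tauto.
  - rewrite ltr0_sg// mulN1r oppr_lt0 => fx; have := ltW f0; have := ltW fx.
    by case: (leP 0 x) => _ ? ?; rewrite ge_min le_max;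
      apply/andP; split; apply/orP; tauto.
by have := fN0 y; rewrite fy eqxx.
Qed.

(* The Lamperti transform is the inverse of one trajectory of the flow. *)
Lemma lamperti {R : realType} (sigma G : R -> R) (c : R) :
  continuous sigma -> 0 < c -> (forall x, c <= `|sigma x|) ->
  (forall u, is_derive u (1 : R) G (sigma (G u))) ->
  exists F : R -> R, forall x, is_derive x (1 : R) F (sigma x)^-1.
Proof.
move=> sc c0 sge Gd.
have [s ss sc'] := norm_bounded_below_sign sc c0 sge.
have sN0 x : sigma x != 0 by rewrite -normr_gt0 (lt_le_trans c0).
have Gc : continuous G by move=> x; exact: is_derive1_continuous (Gd x).
have Ginj : injective G.
  move=> u v /eqP; have [w _] := mean_value v u Gd.
  by rewrite -subr_eq0 => -> /=; rewrite mulf_eq0 (negbTE (sN0 _)) subr_eq0 => /eqP.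
have Gexp u v : u <= v -> c * (v - u) <= s * (G v - G u).
  by move=> uv; have [w _ ->] := mean_value u v Gd; rewrite mulrA ler_wpM2r ?subr_ge0.
have Gsurj y : exists u, G u = y.
  (* By [Gexp], [G] moves in the direction [s] with speed at least [c]; up to the times [M] and
     [- M] it has moved by at least the distance from [G 0] to [y], so its values there enclose
     [y]. *)
  pose M := `|y - G 0| / c.
  have M0 : 0 <= M by rewrite divr_ge0// ltW.
  have cM : c * M = `|y - G 0| by rewrite mulrC divfK ?gt_eqF.
  have s1 : s = 1 \/ s = - 1.
    have : (s == 1) || (s == - 1) by rewrite -eqf_sqr expr2 ss expr1n.
    by move=> /orP[/eqP|/eqP]; [left|right].
  have My : Num.min (G (- M)) (G M) <= y <= Num.max (G (- M)) (G M).
    have h1 := Gexp _ _ M0; rewrite subr0 cM in h1.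
    have M0' : - M <= 0 by rewrite oppr_le0.
    have h2 := Gexp _ _ M0'; rewrite sub0r opprK cM in h2.
    have h3 := ler_norm (y - G 0).
    have h4 := ler_norm (- (y - G 0)); rewrite normrN in h4.
    rewrite ge_min le_max.
    case: s1 => s1; rewrite s1 ?mul1r ?mulN1r in h1 h2; apply/andP; split; apply/orP.
    - by left; lra.
    - by right; lra.
    - by right; lra.
    - by left; lra.
  have M2 : - M <= M by lra.
  by have [|u _ <-] := IVT M2 _ My; [exact: continuous_subspaceT|exists u].
have /choice[F GF] := Gsurj.
have FG : cancel G F by move=> u; apply: Ginj.
exists F => x; have := Gd (F x); rewrite GF => d.
rewrite -{1}[x]GF; apply: (@is_derive_inverse _ G) d (sN0 x).
- by apply: filterE; exact: FG.
- by apply: filterE; exact: Gc.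
Qed.

(** Along the flow, F(h(y, u)) has derivative sigma / sigma = 1 in u: the transform straightens the
    flow into a translation. *)
Lemma lamperti_flow {R : realType} (sigma F : R -> R) (h : R -> R -> R) :
  (forall x, sigma x != 0) -> doss_flow sigma h ->
  (forall x, is_derive x (1 : R) F (sigma x)^-1) ->
  forall y r, F (h y r) = F y + r.
Proof.
move=> sN0 hf Fd y r; have [h0 hd] := hf y.
have : forall u, is_derive u (1 : R) (fun u => F (h y u) - u) 0.
  move=> u; have h1 := hd u; have h2 := Fd (h y u).
  have -> : (fun u => F (h y u) - u) = (F \o h y) - id by [].
  by apply: is_derive_eq; rewrite mulVf// subrr.
move=> /(@is_derive_0_is_cst _ _ r 0); rewrite /= h0 subr0 => <-.
by rewrite subrK.
Qed.

Lemma oint_primitive {R : realType} (f F : R -> R) (a b : R) :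
  continuous f -> (forall x, is_derive x (1 : R) F (f x)) ->
  oint a b f = F b - F a.
Proof.
move=> fc Fd.
have H u v : u <= v -> \int[lebesgue_measure]_(s in `[u, v]) f s = F v - F u.
  rewrite le_eqVlt => /predU1P[->|uv].
    by rewrite set_itv1 Rintegral_set1 subrr.
  have Fc : continuous F by move=> x; exact: is_derive1_continuous (Fd x).
  rewrite /Rintegral (@continuous_FTC2 _ f F)//.
  - exact: continuous_subspaceT.
  - split; first by move=> x _; have [] := Fd x.
      exact: cvg_at_right_filter (Fc u).
    exact: cvg_at_left_filter (Fc v).
  - by move=> x _; rewrite derive1E; have [_ ->] := Fd x.
rewrite /oint; case: (leP a b) => [/H//|/ltW/H ->]; ring.
Qed.

(* [ln (s sigma (h y r))] is a primitive of [sigma' (h y r)] in [r]. *)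
Lemma doss_flow_exp {R : realType} (sigma sigma' : R -> R) (h : R -> R -> R) (c : R) :
  continuous sigma' -> (forall x, is_derive x (1 : R) sigma (sigma' x)) ->
  0 < c -> (forall x, c <= `|sigma x|) -> doss_flow sigma h ->
  forall y r, expR (- oint 0 r (fun s => sigma' (h y s))) = sigma y / sigma (h y r).
Proof.
move=> sc sd c0 sge hf y r; have [h0 hd] := hf y.
have sigc : continuous sigma by move=> x; exact: is_derive1_continuous (sd x).
have [s ss sc'] := norm_bounded_below_sign sigc c0 sge.
have sp x : 0 < s * sigma x by exact: lt_le_trans (sc' x).
have sN0 x : sigma x != 0 by rewrite -normr_gt0 (lt_le_trans c0).
have s0 : s != 0.
  by apply/eqP => s0; move/eqP: ss; rewrite s0 mul0r eq_sym oner_eq0.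
have hc : continuous (h y) by move=> x; exact: is_derive1_continuous (hd x).
(* The sign [s] makes the argument of the logarithm positive; it cancels in the final quotient. *)
have -> : oint 0 r (fun s => sigma' (h y s)) =
    ln (s * sigma (h y r)) - ln (s * sigma (h y 0)).
  apply: (@oint_primitive _ _ (fun u => ln (s * sigma (h y u)))).
    by move=> x; apply: continuous_comp; [exact: hc|exact: sc].
  move=> u; have h1 := hd u; have h2 := sd (h y u).
  have h3 := is_derive1_ln (sp (h y u)).
  have -> : (fun u => ln (s * sigma (h y u))) = @ln R \o (s *: (sigma \o h y)) by [].
  apply: is_derive_eq.
  by rewrite /GRing.scale/= invfM; field; rewrite s0 sN0.
rewrite h0 opprB expRD expRN !lnK ?posrE//.
by field; rewrite s0 sN0.
Qed.

(** * Equations driven by a rough path *)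

Lemma primitive_continuous_derivable {R : realType} (f : R -> R) (T : R) :
  0 < T -> {within `[0, T], continuous f} ->
  let A t := \int[lebesgue_measure]_(s in `[0, t]) f s in
  {within `[0, T], continuous A} /\
  forall t, 0 < t < T -> is_derive t (1 : R) A (f t).
Proof.
move=> T0 fc A.
have fint : lebesgue_measure.-integrable `[0, T] (EFin \o f).
  by apply: continuous_compact_integrable => //; exact: segment_compact.
split; first exact: parameterized_integral_continuous (ltW T0) fint.
move=> t /andP[t0 tT].
have ft : {for t, continuous f}.
  have := fc; rewrite (continuous_within_itvP _ T0) => -[H _ _].
  by apply: H; rewrite in_itv/= t0.
have [Ad AE] := continuous_FTC1_closed tT fint t0 ft.
by split; [exact: Ad|rewrite -derive1E; exact: AE].
Qed.

Lemma within_segment_continuous {R : realType} (f : R -> R) (a b s t : R) :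
  a <= s -> t <= b -> {within `[a, b], continuous f} ->
  {within `[s, t], continuous f}.
Proof.
move=> as_ tb; apply: continuous_subspaceW => u /=.
rewrite !in_itv/= => /andP[su ut].
by rewrite (le_trans as_ su) (le_trans ut tb).
Qed.

Lemma within_continuous_comp {R : realType} (f x : R -> R) (D : set R) :
  continuous f -> {within D, continuous x} -> {within D, continuous (f \o x)}.
Proof.
by move=> fc xc u; apply: (@continuous_comp (subspace D)); [exact: xc|exact: fc].
Qed.

(** Chain rule in the form of an increment estimate. On a fine partition each increment of F(x) is
    that of x divided by sigma at some time of the cell; taking this time as the tag in Henstock's
    lemma turns the quotient into an increment of g, a drift term b / sigma and a summable error.
    The drift and sigma are evaluated at different times, hence the two variables y and z in the
    hypothesis. *)
Lemma pathwise_increment {R : realType} (T x0 c l e : R) (b sigma F g x : R -> R)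
    (s t : R) :
  0 < T -> continuous b -> 0 < c -> (forall x, c <= `|sigma x|) ->
  (forall x, is_derive x (1 : R) F (sigma x)^-1) ->
  solves_pathwise T x0 b sigma g x ->
  0 <= s -> s <= t -> t <= T ->
  (forall y z, s <= y <= t -> s <= z <= t -> `|b (x z) / sigma (x y) - l| <= e) ->
  `|F (x t) - g t - (F (x s) - g s) - l * (t - s)| <= e * (t - s).
Proof.
move=> T0 bc c0 sge Fd [xc x0E xI] s0 st tT Hl.
have sN0 y : sigma y != 0 by rewrite -normr_gt0 (lt_le_trans c0).
have bxc : {within `[0, T], continuous (b \o x)}.
  exact: within_continuous_comp bc xc.
pose A u := \int[lebesgue_measure]_(s in `[0, u]) b (x s).
have [Ac Ad] := primitive_continuous_derivable T0 bxc; rewrite -/A in Ac Ad.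
(* The indefinite integral of sigma(x) against g is read off the equation. *)
pose I u := x u - x0 - A u.
have HI u : 0 <= u <= T -> RS_integral (fun s => sigma (x s)) g 0 u (I u).
  by move=> /xI[J + xu]; suff -> : J = I u by []; rewrite /I xu /A; ring.
apply/ler_addgt0Pr => d d0.
(* The errors of Henstock's lemma will be divided by sigma, at least [c] in absolute value, which
   leaves the slack [d]. *)
have cd0 : 0 < c * d by rewrite mulr_gt0.
have [r r0 Hr] := RS_henstock HI s0 tT st cd0.
have [k [u [u0 uk Hu]]] := fine_partition st r0.
have uge i : (i <= k)%N -> s <= u i.
  elim: i => [_|i IH ik]; first by rewrite u0.
  by have [h1 _] := Hu i ik; apply: le_trans (IH (ltnW ik)) h1.
have ule i : (i <= k)%N -> u i <= t.
  move=> ik; rewrite -(subKn ik).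
  elim: (k - i)%N => [|j IH]; first by rewrite subn0 uk.
  have [kj|kj] := leqP k j.
    by move: IH; rewrite subnS; move/eqP: kj => ->.
  have kk : (k - j.+1 < k)%N by rewrite ltn_subrL (leq_ltn_trans _ kj).
  by have [h1 _] := Hu _ kk; apply: le_trans IH; rewrite subnSK in h1.
(* [p.1] is the time at which x takes the intermediate value given by the mean value theorem for
   [F]; [p.2] is the mean value time for [A]. *)
have /choice[p Hp] i : exists p : R * R, (i < k)%N ->
    [/\ u i <= p.1 <= u i.+1, u i <= p.2 <= u i.+1,
        F (x (u i.+1)) - F (x (u i)) = (sigma (x p.1))^-1 * (x (u i.+1) - x (u i))
      & A (u i.+1) - A (u i) = b (x p.2) * (u i.+1 - u i)].
  have [ik|] := ltnP i k; last by exists (0, 0).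
  have [ui _] := Hu i ik.
  have ui0 : 0 <= u i by exact: le_trans s0 (uge _ (ltnW ik)).
  have uiT : u i.+1 <= T by exact: le_trans (ule _ ik) tT.
  have [y xy Fy] := mean_value (x (u i)) (x (u i.+1)) Fd.
  have [y' y'u xy'] := IVT ui (within_segment_continuous ui0 uiT xc) xy.
  have Adi z : z \in `]u i, u i.+1[ -> is_derive z (1 : R) A ((b \o x) z).
    rewrite in_itv/= => /andP[uz zu]; apply: Ad.
    by rewrite (le_lt_trans ui0 uz) (lt_le_trans zu uiT).
  have [z zu Az] := MVT_segment ui Adi (within_segment_continuous ui0 uiT Ac).
  by exists (y', z) => _; split; rewrite //= xy'.
have tel (f : R -> R) : f t - f s = \sum_(i < k) (f (u i.+1) - f (u i)).
  rewrite -(big_mkord xpredT (fun i => f (u i.+1) - f (u i))).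
  by rewrite (@telescope_sumr _ _ _ (f \o u))//= u0 uk.
pose err i := I (u i.+1) - I (u i) - sigma (x (p i).1) * (g (u i.+1) - g (u i)).
have -> : F (x t) - g t - (F (x s) - g s) - l * (t - s) =
    \sum_(i < k) ((b (x (p i).2) / sigma (x (p i).1) - l) * (u i.+1 - u i)
                  + err i / sigma (x (p i).1)).
  have := tel (fun u => F (x u) - g u - l * u); rewrite /= => telF.
  transitivity (F (x t) - g t - l * t - (F (x s) - g s - l * s)); first by ring.
  rewrite telF; apply: eq_bigr => i _; have [_ _ Fi Ai] := Hp i (ltn_ord i).
  have -> : F (x (u i.+1)) - g (u i.+1) - l * u i.+1 - (F (x (u i)) - g (u i) - l * u i)
    = (F (x (u i.+1)) - F (x (u i))) - (g (u i.+1) - g (u i)) - l * (u i.+1 - u i).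
    by ring.
  rewrite Fi /err /I.
  have -> : x (u i.+1) - x0 - A (u i.+1) - (x (u i) - x0 - A (u i)) =
    x (u i.+1) - x (u i) - (A (u i.+1) - A (u i)) by ring.
  by rewrite Ai; field.
rewrite big_split/=; apply: le_trans (ler_normD _ _) _; apply: lerD.
  have -> : e * (t - s) = \sum_(i < k) e * (u i.+1 - u i) by rewrite -mulr_sumr -(tel id).
  apply: le_trans (ler_norm_sum _ _ _) _; apply: ler_sum => i _.
  have [h1 h2 _ _] := Hp i (ltn_ord i); have [ui _] := Hu i (ltn_ord i).
  rewrite normrM [X in _ * X]ger0_norm ?subr_ge0// ler_wpM2r ?subr_ge0//.
  have sub w : u i <= w <= u i.+1 -> s <= w <= t.
    move=> /andP[uw wu]; rewrite (le_trans (uge _ _) uw) ?(ltnW (ltn_ord i))//=.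
    by rewrite (le_trans wu)// ule.
  by apply: Hl; exact: sub.
have errd : \sum_(i < k) `|err i| <= c * d.
  apply: (Hr _ _ (fun i => (p i).1)) => // i ik.
  by have [/andP[? ?] _ _ _] := Hp i ik; have [_ ?] := Hu i ik.
apply: le_trans (ler_norm_sum _ _ _) _.
rewrite -(ler_pM2l c0); apply: le_trans errd; rewrite mulr_sumr.
apply: ler_sum => i _; rewrite normrM normfV mulrCA ler_piMr//.
by rewrite ler_pdivrMr ?mul1r ?normr_gt0.
Qed.

Lemma is_derive_increment {R : realType} (f : R -> R) (t l : R) :
  (forall e : R, 0 < e -> exists2 d : R, 0 < d &
    forall s, `|s - t| < d -> `|f s - f t - l * (s - t)| <= e * `|s - t|) ->
  is_derive t (1 : R) f l.
Proof.
move=> H.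
have fl : h^-1 *: (f (h *: (1 : R) + t) - f t) @[h --> (0 : R)^'] --> l.
  apply/cvgrPdist_le => e e0; have [d d0 Hd] := H e e0.
  near=> u.
  have u0 : u != 0 by near: u; exact: nbhs_dnbhs_neq.
  have ud : `|u + t - t| < d.
    rewrite addrK; near: u; apply: dnbhs0_lt => //.
  have := Hd _ ud; rewrite addrK => h.
  rewrite distrC /GRing.scale/= mulr1.
  rewrite -(@ler_pM2r _ `|u|) ?normr_gt0// -normrM mulrBl mulrAC mulVf// mul1r.
  exact: h.
by split; [apply/cvg_ex; exists l|exact: cvg_lim].
Unshelve. all: by end_near.
Qed.

Lemma lipschitz_within_continuous {R : realType} (f : R -> R) (a b M : R) :
  (forall s t, a <= s -> s <= t -> t <= b -> `|f t - f s| <= M * (t - s)) ->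
  {within `[a, b], continuous f}.
Proof.
move=> fM; apply/subspace_continuousP => t /=; rewrite in_itv/= => /andP[at_ tb].
apply/cvgrPdist_le => e e0; pose N := `|M| + 1.
have N0 : 0 < N by rewrite ltr_wpDl.
apply/nbhs_ballP; exists (e / N) => /=; first by rewrite divr_gt0.
move=> s /=; rewrite /ball/= => st; rewrite in_itv/= => /andP[as_ sb].
apply: (@le_trans _ _ (N * `|t - s|)); last first.
  by rewrite mulrC -ler_pdivlMr// ltW.
have MN : M <= N by rewrite (le_trans (ler_norm M))// lerDl.
have [ts|/ltW ts] := leP s t.
  rewrite [`|t - s|]ger0_norm ?subr_ge0//.
  by apply: le_trans (fM _ _ as_ ts tb) _; rewrite ler_wpM2r ?subr_ge0.
rewrite distrC [`|t - s|]distrC [`|s - t|]ger0_norm ?subr_ge0//.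
by apply: le_trans (fM _ _ at_ ts sb) _; rewrite ler_wpM2r ?subr_ge0.
Qed.

(** The roughness of g cancels in F(x) - g. The increment estimate with slope 0 and error M / c
    gives a Lipschitz bound, hence continuity; with slope b / sigma at time t and small error near
    t, it gives the derivative. *)
Lemma pathwise_transform {R : realType} (T x0 c M : R) (b sigma F g x : R -> R) :
  0 < T -> continuous b -> continuous sigma -> (forall y, `|b y| <= M) ->
  0 < c -> (forall y, c <= `|sigma y|) ->
  (forall y, is_derive y (1 : R) F (sigma y)^-1) ->
  solves_pathwise T x0 b sigma g x ->
  {within `[0, T], continuous (fun t => F (x t) - g t)} /\
  forall t, 0 < t < T ->
    is_derive t (1 : R) (fun t => F (x t) - g t) (b (x t) / sigma (x t)).
Proof.
move=> T0 bc sc bM c0 sge Fd hx.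
have M0 : 0 <= M := le_trans (normr_ge0 _) (bM 0).
have sN0 y : sigma y != 0 by rewrite -normr_gt0 (lt_le_trans c0).
have inc := pathwise_increment T0 bc c0 sge Fd hx.
have sV y : `|(sigma y)^-1| <= c^-1.
  by rewrite normfV lef_pV2 ?posrE ?normr_gt0.
split.
  apply: (@lipschitz_within_continuous _ _ _ _ (M / c)) => s t s0 st tT.
  have := inc 0 (M / c) s t s0 st tT.
  rewrite mul0r subr0; apply => y z _ _; rewrite subr0 normrM.
  by rewrite ler_pM.
move=> t /andP[t0 tT].
have [xc _ _] := hx.
have xt : {for t, continuous x}.
  move: xc; rewrite (continuous_within_itvP _ T0) => -[H _ _].
  by apply: H; rewrite in_itv/= t0.
have bxt : {for t, continuous (b \o x)}.
  by apply: continuous_comp; [exact: xt|exact: bc].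
have sxt : {for t, continuous (fun y => (sigma (x y))^-1)}.
  apply: continuousV => //; apply: (@continuous_comp _ _ _ x) => //; exact: sc.
apply: is_derive_increment => e e0.
(* The variation of b is multiplied by at most 1 / c and that of 1 / sigma by at most M, so each
   costs at most e / 2; [M + 1] avoids a division by zero. *)
pose e1 := c * (e / 2); pose e2 := e / 2 / (M + 1).
have M1 : 0 < M + 1 by rewrite ltr_wpDl.
have e10 : 0 < e1 by rewrite mulr_gt0 ?divr_gt0.
have e20 : 0 < e2 by rewrite divr_gt0 ?divr_gt0.
move/cvgrPdist_le : bxt => /(_ _ e10) /nbhs_ballP[d1 /= d10 H1].
move/cvgrPdist_le : sxt => /(_ _ e20) /nbhs_ballP[d2 /= d20 H2].
(* The bounds [t] and [T - t] keep [s] inside [0, T]. *)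
pose d := Num.min (Num.min d1 d2) (Num.min t (T - t)).
exists d; first by rewrite !lt_min d10 d20 t0 subr_gt0.
move=> s; rewrite !lt_min => /andP[/andP[sd1 sd2] /andP[sdt sdT]].
have s0 : 0 <= s by have := ler_norm (- (s - t)); rewrite normrN; lra.
have sT : s <= T by have := ler_norm (s - t); lra.
(* The increment estimate needs ordered times; this form serves both for s after t and for s before
   t. *)
have key (u v : R) : 0 <= u -> u <= v -> v <= T -> `|v - t| <= `|s - t| ->
    `|u - t| <= `|s - t| ->
    `|F (x v) - g v - (F (x u) - g u) - b (x t) / sigma (x t) * (v - u)|
      <= e * (v - u).
  move=> u0 uv vT vs us; apply: inc => // y z yuv zuv.
  have near w : u <= w <= v -> `|t - w| <= `|s - t|.
    move=> /andP[uw wv]; move: us vs; rewrite (distrC t) !ler_norml.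
    by move=> /andP[? ?] /andP[? ?]; apply/andP; split; lra.
  have h1 := H1 z (le_lt_trans (near z zuv) sd1).
  have h2 := H2 y (le_lt_trans (near y yuv) sd2).
  rewrite /= distrC in h1; rewrite /= distrC in h2.
  have -> : b (x z) / sigma (x y) - b (x t) / sigma (x t) =
    (b (x z) - b (x t)) / sigma (x y) +
    b (x t) * ((sigma (x y))^-1 - (sigma (x t))^-1) by ring.
  apply: le_trans (ler_normD _ _) _; rewrite !normrM [leRHS](splitr e).
  apply: lerD.
    apply: (@le_trans _ _ (e1 / c)); first by rewrite ler_pM.
    by rewrite /e1 mulrC mulKf ?gt_eqF.
  apply: (@le_trans _ _ ((M + 1) * e2)).
    by rewrite ler_pM// (le_trans (bM _))// lerDl.
  by rewrite /e2 mulrC divfK ?gt_eqF.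
have [ts|/ltW ts] := leP t s.
  have h : `|t - t| <= `|s - t| by rewrite subrr normr0.
  have := key t s (ltW t0) ts sT (lexx _) h.
  by rewrite -[X in _ <= e * X]ger0_norm ?subr_ge0.
have h : `|t - t| <= `|s - t| by rewrite subrr normr0.
have := key s t s0 ts (ltW tT) h (lexx _).
rewrite -[X in _ <= e * X]ger0_norm ?subr_ge0// (distrC t s).
have -> : F (x s) - g s - (F (x t) - g t) - b (x t) / sigma (x t) * (s - t) =
  - (F (x t) - g t - (F (x s) - g s) - b (x t) / sigma (x t) * (t - s)) by ring.
by rewrite normrN.
Qed.

(** * Gronwall estimate and comparison of solutions *)

(* [D ^ 2 + m ^ 2] is differentiable and grows at rate at most [3 L]. *)
Lemma gronwall_affine {R : realType} (D D' : R -> R) (T L m : R) :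
  0 < T -> 0 <= L -> 0 <= m -> {within `[0, T], continuous D} -> D 0 = 0 ->
  (forall t, 0 < t < T -> is_derive t (1 : R) D (D' t)) ->
  (forall t, 0 < t < T -> `|D' t| <= L * (`|D t| + m)) ->
  forall t, 0 <= t <= T -> `|D t| <= m * expR (2 * L * T).
Proof.
move=> T0 L0 m0 Dc D0 Dd DL t t0T; have /andP[t0 tT] := t0T.
pose N u := (D u ^+ 2 + m ^+ 2) * expR (- (3 * L) * u).
have Nd u : 0 < u < T -> is_derive u (1 : R) N
    ((2 * D u * D' u - 3 * L * (D u ^+ 2 + m ^+ 2)) * expR (- (3 * L) * u)).
  move=> u0T; have h1 := Dd u u0T.
  have -> : N = ((fun u => D u ^+ 2) + cst (m ^+ 2)) * (expR \o ( *%R (- (3 * L)))) by [].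
  apply: is_derive_eq; rewrite /GRing.scale/= !fctE/=; ring.
have Nle : N t <= N 0.
  have Nc : {within `[0, T], continuous N}.
    move=> u; apply: (@continuousM _ (subspace `[0, T])
      (fun u => D u ^+ 2 + m ^+ 2) (fun u => expR (- (3 * L) * u)) u).
      apply: (@continuousD _ _ (subspace `[0, T])
        (fun u => D u ^+ 2) (cst (m ^+ 2)) u); last exact: cst_continuous.
      by apply: (@continuousM _ (subspace `[0, T]) D D u); exact: Dc.
    apply: continuous_subspaceT => {}u.
    by apply: continuous_comp; [exact: mulrl_continuous|exact: continuous_expR].
  apply: (ler0_derive1_le_cc _ _ Nc) => //.
  - by move=> u; rewrite in_itv/= => /Nd[].
  - move=> u; rewrite in_itv/= => u0T; rewrite derive1E; have [_ ->] := Nd u u0T.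
    rewrite mulr_le0_ge0 ?expR_ge0// subr_le0 -mulrA.
    have h1 : D u * D' u <= `|D u| * (L * (`|D u| + m)).
      by rewrite (le_trans (ler_norm _))// normrM ler_wpM2l// DL.
    (* This is 3 L (D^2 + m^2) - 2 L |D| (|D| + m) after completing the square. *)
    have h2 : 0 <= L * ((`|D u| - m) ^+ 2 + 2 * m ^+ 2).
      by rewrite mulr_ge0// addr_ge0 ?sqr_ge0// mulr_ge0// sqr_ge0.
    rewrite -[D u ^+ 2](real_normK (num_real _)); nra.
  - by rewrite in_itv/= lexx ltW.
rewrite -(@ler_pXn2r _ 2) ?nnegrE ?mulr_ge0 ?expR_ge0//.
rewrite real_normK ?num_real//.
move: Nle; rewrite /N D0 mulr0 expR0 mulr1 expr0n/= add0r mulNr expRN.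
rewrite ler_pdivrMr ?expR_gt0// => h.
apply: (@le_trans _ _ (D t ^+ 2 + m ^+ 2)); first by rewrite lerDl sqr_ge0.
apply: (le_trans h); rewrite exprMn ler_wpM2l ?sqr_ge0//.
(* After squaring, the claimed bound has exponent 4 L T, which exceeds 3 L t. *)
rewrite -expRM_natl ler_expR.
rewrite mulrA; apply: ler_pM => //; first by rewrite mulr_ge0.
by rewrite mulrA ler_wpM2r//; lra.
Qed.

(** By [doss_flow_exp] the exponential factor of the equation is sigma(y) / sigma(h(y, g)), and
    F'(y) = 1 / sigma(y) cancels its numerator. *)
Lemma doss_transform {R : realType} (T x0 c : R) (b sigma sigma' F g y : R -> R)
    (h : R -> R -> R) :
  continuous sigma' -> (forall u, is_derive u (1 : R) sigma (sigma' u)) ->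
  0 < c -> (forall u, c <= `|sigma u|) -> doss_flow sigma h ->
  (forall u, is_derive u (1 : R) F (sigma u)^-1) ->
  doss_path T x0 b sigma h g y ->
  {within `[0, T], continuous (F \o y)} /\
  forall t, 0 < t < T -> is_derive t (1 : R) (F \o y)
    (b (h (y t) (g t)) / sigma (h (y t) (g t))).
Proof.
move=> s'c sd c0 sge hf Fd [yc y0 yd]; split.
  by apply: within_continuous_comp yc => u; exact: is_derive1_continuous (Fd u).
have sN0 u : sigma u != 0 by rewrite -normr_gt0 (lt_le_trans c0).
have s'E : derive1 sigma = sigma'.
  by apply/funext => u; rewrite derive1E; have [_ ->] := sd u.
move=> t /yd; rewrite s'E (doss_flow_exp s'c sd c0 sge hf) => h1.
have h2 := Fd (y t).
by apply: is_derive_eq; field; rewrite !sN0.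
Qed.

Lemma quotient_lipschitz {R : realType} (c M N S : R) (b sigma : R -> R) :
  0 < c -> (forall u, c <= `|sigma u|) -> (forall u, `|b u| <= M) ->
  (forall u v, `|b u - b v| <= N * `|u - v|) ->
  (forall u v, `|sigma u - sigma v| <= S * `|u - v|) ->
  forall u v, `|b u / sigma u - b v / sigma v| <=
    (N / c + M * S / c ^+ 2) * `|u - v|.
Proof.
move=> c0 sge bM bN sS u v.
have sN0 w : sigma w != 0 by rewrite -normr_gt0 (lt_le_trans c0).
have sV w : `|(sigma w)^-1| <= c^-1.
  by rewrite normfV lef_pV2 ?posrE ?normr_gt0.
have -> : b u / sigma u - b v / sigma v = (b u - b v) / sigma u +
    b v * (sigma v - sigma u) * ((sigma u)^-1 * (sigma v)^-1).
  by field; rewrite !sN0.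
apply: le_trans (ler_normD _ _) _; rewrite [leRHS]mulrDl; apply: lerD.
  by rewrite normrM mulrAC ler_pM.
have -> : M * S / c ^+ 2 * `|u - v| = M * (S * `|u - v|) * (c^-1 * c^-1).
  by field; rewrite gt_eqF.
rewrite 3!normrM; apply: ler_pM; rewrite ?mulr_ge0//; last by rewrite ler_pM.
by rewrite ler_pM// distrC.
Qed.

(** In Lamperti coordinates both noises are additive, so the difference of the two noise-free parts
    has a derivative controlled by itself and by the distance [m] of the noises. Gronwall bounds it,
    and the bound is carried back to x and xn. *)
Lemma pathwise_comparison {R : realType} (T x0 c K M L m : R)
    (b sigma sigma' F g gn y x xn : R -> R) (h : R -> R -> R) :
  0 < T -> continuous b -> (forall u, `|b u| <= M) ->
  continuous sigma' -> (forall u, is_derive u (1 : R) sigma (sigma' u)) ->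
  0 < c -> (forall u, c <= `|sigma u|) -> (forall u, `|sigma u| <= K) ->
  0 <= L ->
  (forall u v, `|b u / sigma u - b v / sigma v| <= L * `|u - v|) ->
  doss_flow sigma h -> (forall u, is_derive u (1 : R) F (sigma u)^-1) ->
  doss_path T x0 b sigma h g y -> (forall t, 0 <= t <= T -> x t = h (y t) (g t)) ->
  x 0 = x0 -> solves_pathwise T x0 b sigma gn xn ->
  (forall t, 0 <= t <= T -> `|g t - gn t| <= m) ->
  forall t, 0 <= t <= T ->
    `|x t - xn t| <= K * (2 * m * (expR (2 * (L * K) * T) + 1)).
Proof.
move=> T0 bc bM s'c sd c0 sge sK L0 qL hf Fd dp xE x00 sp gm t tT.
have sN0 u : sigma u != 0 by rewrite -normr_gt0 (lt_le_trans c0).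
have K0 : 0 < K by rewrite (lt_le_trans c0)// (le_trans (sge 0)).
have sc : continuous sigma by move=> u; exact: is_derive1_continuous (sd u).
have Fh := lamperti_flow sN0 hf Fd.
(* The derivative of [F] is at least 1 / K in absolute value, so distances are recovered from those
   of their images. *)
have FK u v : `|u - v| <= K * `|F u - F v|.
  have [w _ ->] := mean_value v u Fd.
  by rewrite normrM normfV mulrA ler_peMl// ler_pdivlMr ?mul1r ?normr_gt0.
have z0T : (0 : R) <= 0 <= T by rewrite lexx ltW.
have [_ y0 _] := dp; have [_ xn0 _] := sp.
(* The representation at time 0 reads x0 = h(x0, g 0), and by [lamperti_flow] a flow line returns to
   its origin only at parameter 0. *)
have g0 : g 0 = 0.
  have := Fh (y 0) (g 0); rewrite -xE// x00 y0 => F0.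
  by apply: (addrI (F x0)); rewrite addr0 -F0.
have m0 : 0 <= m by exact: le_trans (gm 0 z0T).
have gn0 : `|gn 0| <= m by have := gm 0 z0T; rewrite g0 sub0r normrN.
have [Vc Vd] := doss_transform s'c sd c0 sge hf Fd dp.
have [Wc Wd] := pathwise_transform T0 bc sc bM c0 sge Fd sp.
(* Subtracting [gn 0] gives D(0) = 0 even when the approximate noise does not start at 0; since
   [gn 0] is at most [m] in absolute value, this turns [m] into [2 * m]. *)
pose D t := F (y t) - (F (xn t) - gn t) - gn 0.
have xnD s : 0 <= s <= T -> `|F (x s) - F (xn s)| <= `|D s| + 2 * m.
  move=> sT; rewrite xE// Fh /D.
  have -> : F (y s) + g s - F (xn s) =
    (F (y s) - (F (xn s) - gn s) - gn 0) + ((g s - gn s) + gn 0) by ring.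
  apply: le_trans (ler_normD _ _) _; rewrite lerD2l.
  by apply: le_trans (ler_normD _ _) _; have := gm s sT; lra.
have Dc : {within `[0, T], continuous D}.
  move=> u; apply: (@continuousB _ _ (subspace `[0, T])
    (fun t => F (y t) - (F (xn t) - gn t)) (cst (gn 0)) u); last exact: cst_continuous.
  apply: (@continuousB _ _ (subspace `[0, T]) (F \o y)
    (fun t => F (xn t) - gn t) u); first exact: Vc.
  exact: Wc.
have D0 : D 0 = 0 by rewrite /D y0 xn0; ring.
have Dd s : 0 < s < T -> is_derive s (1 : R) D
    (b (x s) / sigma (x s) - b (xn s) / sigma (xn s)).
  move=> sT; have h1 := Vd s sT; have h2 := Wd s sT.
  have sT' : 0 <= s <= T by case/andP: sT => ? ?; rewrite !ltW.
  rewrite -xE// in h1.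
  have -> : D = (F \o y) - (fun t => F (xn t) - gn t) - cst (gn 0) by [].
  by apply: is_derive_eq; rewrite subr0.
have DL s : 0 < s < T -> `|b (x s) / sigma (x s) - b (xn s) / sigma (xn s)| <=
    (L * K) * (`|D s| + 2 * m).
  move=> /andP[s0 sT]; apply: le_trans (qL _ _) _; rewrite -mulrA ler_wpM2l//.
  by apply: le_trans (FK _ _) _; rewrite ler_pM2l// xnD// !ltW.
have LK0 : 0 <= L * K by rewrite mulr_ge0// ltW.
have m20 : 0 <= 2 * m by rewrite mulr_ge0.
have DE := gronwall_affine T0 LK0 m20 Dc D0 Dd DL tT.
apply: le_trans (FK _ _) _; rewrite ler_pM2l// mulrDr mulr1.
by apply: le_trans (xnD _ tT) _; rewrite lerD2r.
Qed.

(** * Outer probability and deviation events *)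

Lemma bounded_fun_ex {R : realType} (f : R -> R) :
  bounded_fun f -> exists2 M, 0 <= M & forall x, `|f x| <= M.
Proof.
move=> [N [_ hN]]; exists (`|N| + 1) => [|x]; first by rewrite addr_ge0.
by apply: (hN (`|N| + 1)) => //; rewrite (le_lt_trans (ler_norm N))// ltrDl.
Qed.

Lemma outer_measure_negligible {R : realType} (d : measure_display)
    (Omega : measurableType d) (P : probability Omega R) (N : set Omega) :
  P.-negligible N -> (P^*)%mu N = 0%E.
Proof.
move=> [B [mB PB NB]]; apply/eqP; rewrite eq_le mu_ext_ge0// andbT.
by rewrite -PB -measurable_mu_extE//; exact: le_mu_ext.
Qed.

(** A is covered by B and the null set where the implication fails, so monotonicity and
    subadditivity of the outer measure suffice and no measurability of the events is required. Outer
    probabilities are at most 1, which lets [fine] preserve the order. *)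
Lemma fine_outer_le_ae {R : realType} (d : measure_display)
    (Omega : measurableType d) (P : probability Omega R) (A B : set Omega) :
  {ae P, forall w, A w -> B w} -> fine ((P^*)%mu A) <= fine ((P^*)%mu B).
Proof.
move=> AB.
have fin X : ((P^*)%mu X \is a fin_num)%E.
  rewrite ge0_fin_numE ?mu_ext_ge0//; apply: (@le_lt_trans _ _ 1%E); last exact: ltry.
  rewrite -(probability_setT P) -measurable_mu_extE//.
  by apply: le_mu_ext; exact: subsetT.
rewrite fine_le//; apply: (@le_trans _ _ ((P^*)%mu (B `|` ~` [set w | A w -> B w]))).
  by apply: le_mu_ext => w Aw; have [?|h] := pselect (B w); [left|right => /(_ Aw)].
apply: le_trans (outer_measureU2 _ _ _) _.
by rewrite [X in (_ + X)%E](outer_measure_negligible AB) adde0.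
Qed.

Lemma sup_dist_le {R : realType} (Omega : Type) (D : set R)
    (U V : R -> Omega -> R) (w : Omega) (m : R) :
  (sup_dist D U V w <= m%:E)%E <-> (forall t, D t -> `|U t w - V t w| <= m).
Proof.
split=> [h t Dt|h].
  by rewrite -lee_fin; apply: le_trans h; apply: ereal_sup_ubound; exists t.
by apply: ge_ereal_sup => _ [t Dt <-]; rewrite lee_fin h.
Qed.

Unset Implicit Arguments.
Set Strict Implicit.
Set Printing Implicit Defensive.

Theorem theorem3p1 (R : realType) (d : measure_display)
  (Omega : measurableType d) (P : probability Omega R)
  (T H x0 beta a CH : R) (b sigma : R -> R)
  (T_gt0 : 0 < T) (H_gt0 : 0 < H) (H_lt1 : H < 1) (H_neq : H != 2^-1)
  (b_C1b : Cb 1 b) (sigma_C2b : Cb 2 sigma)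
  (sigma_away0 : exists2 c : R, 0 < c & forall x : R, c <= `|sigma x|)
  (beta_gt : `|H - 2^-1| < beta) (beta_lt : beta < 2^-1)
  (a_lt0 : a < 0)
  (* fractional Brownian motion, represented by a two-sided Brownian motion *)
  (B BH : R -> {RV P >-> R})
  (B_brownian : brownian_two_sided B)
  (CH_gt0 : 0 < CH)
  (BH_fbm : fractional_brownian H T BH)
  (BH_repr : moving_average H T CH B BH)
  (* X is the unique solution of the equation driven by BH, for some notion of
     stochastic integral, and has the Doss-Sussmann representation *)
  (BH_integral : (R -> Omega -> R) -> (R -> Omega -> R) -> Prop)
  (X : R -> {RV P >-> R})
  (X_sol : unique_solution_SDE T x0 b sigma BH_integral X)
  (h : R -> R -> R) (h_flow : doss_flow sigma h)
  (Y : R -> Omega -> R)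
  (Y_sol : {ae P, forall w,
     doss_path T x0 b sigma h (fun t => BH t w) (fun t => Y t w)})
  (X_repr : {ae P, forall w, forall t, 0 <= t <= T ->
     X t w = h (Y t w) (BH t w)})
  (* transport processes; Z2 and Z3 run backward from time 0 *)
  (Z1 Z2 Z3 : nat -> R -> {RV P >-> R})
  (Z1_transport : forall n : nat, (0 < n)%N ->
     transport_process P n T (fun s w => Z1 n s w))
  (Z2_transport : forall n : nat, (0 < n)%N ->
     transport_process P n (- a) (fun s w => Z2 n (- s) w))
  (Z3_transport : forall n : nat, (0 < n)%N ->
     transport_process P n (- a^-1) (fun s w => Z3 n (- s) w))
  (Z1_approx : strong_approx P `[0, T] Z1 B)
  (Z2_approx : strong_approx P `[a, 0] Z2 B)
  (Z3_approx : strong_approx P `[a^-1, 0] Z3 (B3 B))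
  (* the known rate of convergence of B^n to BH *)
  (Bn_rate : forall q : R, 0 < q -> exists2 C : R, 0 < C &
     prob_littleo P
       (deviation_event T C (- 2^-1 + beta) BH (Bn H beta CH a Z1 Z2 Z3)) q)
  (* solutions of the equations driven by B^n *)
  (Xn : nat -> R -> {RV P >-> R})
  (Xn_sol : forall n : nat, (0 < n)%N -> {ae P, forall w,
     solves_pathwise T x0 b sigma
       (fun t => Bn H beta CH a Z1 Z2 Z3 n t w) (fun t => Xn n t w)}) :
  forall delta : R, 0 < delta -> beta + delta < 2^-1 ->
  exists q C : R, [/\ 0 < q, 0 < C &
    prob_littleo P (deviation_event T C (- 2^-1 + beta + delta) X Xn) q].
Proof.
move=> delta delta0 _.
have [b1 b2] := b_C1b; have [s1 s2] := sigma_C2b; have [c c0 sge] := sigma_away0.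
have [bc /bounded_fun_ex[M M0 bM]] := b2 0%N isT.
have [_ /bounded_fun_ex[N N0 bN]] := b2 1%N isT.
have [_ /bounded_fun_ex[K K0 sK]] := s2 0%N isT.
have [s'c /bounded_fun_ex[S S0 sS]] := s2 1%N isT.
have bd u : is_derive u (1 : R) b (derive1n 1 b u).
  by rewrite derive1n1 derive1E; apply: derivableP; exact: b1 0%N isT u.
have sd u : is_derive u (1 : R) sigma (derive1n 1 sigma u).
  by rewrite derive1n1 derive1E; apply: derivableP; exact: s1 0%N isT u.
have sc : continuous sigma by move=> u; exact: is_derive1_continuous (sd u).
have qL := quotient_lipschitz c0 sge bM (derive_lipschitz bd bN) (derive_lipschitz sd sS).
set L := (N / c + M * S / c ^+ 2) in qL.
have c0W := ltW c0.
have L0 : 0 <= L by apply: addr_ge0; apply: divr_ge0 => //; rewrite ?sqr_ge0 ?mulr_ge0.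
(* The flow line through 0 is the trajectory that gets inverted. *)
have [F Fd] := lamperti sc c0 sge (fun u => proj2 (h_flow 0) u).
(* The known rate is available for every exponent; the conclusion asks for one, and 1 is taken. *)
have [C C0 HC] := Bn_rate 1 ltr01.
have K1 : 0 < K by rewrite (lt_le_trans c0)// (le_trans (sge 0)).
pose E := expR (2 * (L * K) * T) + 1.
have E0 : 0 < E by rewrite addr_gt0 ?expR_gt0.
(* This is the bound of [pathwise_comparison] with [C] in place of [m]; it depends neither on the
   path nor on [n]. *)
have KCE0 : 0 < K * (2 * C * E).
  by apply: mulr_gt0 => //; apply: mulr_gt0 => //; exact: mulr_gt0.
exists 1, (K * (2 * C * E)); split; [exact: ltr01|exact: KCE0|].
have [[V [_ X_ae]] _] := X_sol.
apply/eqoP => e e0; move/eqoP : HC => /(_ e e0).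
apply: filter_app; near=> n => Cn; apply: le_trans Cn.
have n0 : (0 < n)%N by near: n; exact: nbhs_infty_gt.
rewrite !ger0_norm ?fine_ge0 ?mu_ext_ge0//; apply: fine_outer_le_ae.
have aeF : Filter (nbhs (almost_everywhere P)) := ae_filter_ringOfSetsType P.
apply: filterS3 (filterI X_repr X_ae) Y_sol (Xn_sol n n0).
move=> w [Xw [_ X0 _]] Yw Xnw.
(* By contraposition: if the noises stay within the known rate on this path, the comparison keeps
   the solutions within the claimed one. *)
rewrite /deviation_event/= => dev; rewrite ltNge; apply/negP => /sup_dist_le close.
move: dev; rewrite ltNge => /negP; apply; apply/sup_dist_le => t tT.
have tT' : 0 <= t <= T by move: tT; rewrite /= in_itv.
apply: le_trans (pathwise_comparison T_gt0 bc bM s'c sd c0 sge sK L0 qL h_flow Fd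
  Yw Xw X0 Xnw _ tT') _.
  by move=> s sT; apply: close; rewrite /= in_itv.
(* The comparison preserves the rate of the noise; as n >= 1 and delta > 0, the extra power of n
   only enlarges the threshold. *)
have p_le : n%:R `^ (- 2^-1 + beta) <= n%:R `^ (- 2^-1 + beta + delta) :> R.
  by apply: ler_powR; rewrite ?ler1n// lerDl ltW.
rewrite -/E [leLHS](_ : _ = K * (2 * C * E) *
  (n%:R `^ (- 2^-1 + beta) * ln n%:R `^ (5 / 2))); last by ring.
rewrite -[leRHS]mulrA ler_wpM2l ?ler_wpM2r ?powR_ge0//.
exact: ltW KCE0.
Unshelve. all: by end_near.
Qed.
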